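(* Let $\theta$ be an infinite cardinal number, let $X$ be a zero-dimensional Hausdorff $c$-realcompact space, and let $\mathcal{P}_\theta$ be the ideal of all closed finally $\theta$-compact subsets of $X$. Then $X$ is finally $\theta$-compact if and only if $X$ is $c_{\mathcal{P}_\theta}$-compact.
   Context: A Hausdorff space is zero-dimensional if it has a base of clopen sets. For an infinite cardinal $\theta$, a space is finally $\theta$-compact if each of its open covers has a subcover of cardinality $<\theta$; a subset is finally $\theta$-compact if it is so as a subspace. $C(X)$ is the ring of all real-valued continuous functions on $X$, and $C_c(X)$ is the subring of those $f\in C(X)$ for which $f(X)$ is a countable set. A maximal ideal $M$ of $C_c(X)$ is real if the residue class field $C_c(X)/M$ is isomorphic to the field $\mathbb{R}$; it is fixed if there is a point $x\in X$ such that $f(x)=0$ for every $f\in M$. $X$ is $c$-realcompact if every real maximal ideal of $C_c(X)$ is fixed. A family $\mathcal{P}$ of closed sets in $X$ is an ideal of closed sets if $A,B\in\mathcal{P}$ and $C$ a closed subset of $A$ imply $A\cup B\in\mathcal{P}$ and $C\in\mathcal{P}$. For $f\in C(X)$, $Z(f)=\{x\in X: f(x)=0\}$, and for an ideal $\mathcal{P}$ of closed sets, $C_{\mathcal{P}}(X)=\{f\in C(X): \mathrm{cl}_X(X\setminus Z(f))\in\mathcal{P}\}$. $C(X,\mathbb{Z})$ is the set of continuous functions $X\to\mathbb{Z}$, where $\mathbb{Z}$ has the discrete topology. A family $\mathcal{F}$ of subsets of $X$ is $c_{\mathcal{P}}$-stable if for every $f\in C(X,\mathbb{Z})\cap C_{\mathcal{P}}(X)$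 there exists $F\in\mathcal{F}$ such that $f$ is bounded on $F$. $X$ is $c_{\mathcal{P}}$-compact if every $c_{\mathcal{P}}$-stable family of closed sets in $X$ with the finite intersection property has nonempty intersection. *)

(* Defs.v *)
From HB Require Import structures.
From mathcomp Require Import all_boot all_order all_algebra.
From mathcomp Require Import generic_quotient ring_quotient.
From mathcomp Require Import all_classical all_reals all_analysis.

Set Implicit Arguments.
Unset Strict Implicit.
Unset Printing Implicit Defensive.

Import Order.TTheory GRing.Theory Num.Theory.
Import numFieldNormedType.Exports.

Local Open Scope classical_set_scope.
Local Open Scope ring_scope.

Definition card_lt (T U : Type) (A : set T) (B : set U) : bool :=
  (A #<= B)%card && ~~ (B #<= A)%card.

(* The library's [zero_dimensional] only asks that distinct points be separated
   by clopen sets, which is weaker than having a clopen base. *)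
Definition has_clopen_base (X : topologicalType) :=
  exists2 B : set (set X), basis B & B `<=` clopen.

(* A cardinal is given by a type [theta] of that cardinality. *)
Definition finally_compact (theta : Type) (X : topologicalType) :=
  forall U : set (set X), U `<=` open -> \bigcup_(A in U) A = setT ->
  exists V : set (set X),
    [/\ V `<=` U, \bigcup_(A in V) A = setT & card_lt V [set: theta]].

(* [set_type A] carries the subspace topology (the initial one for inclusion). *)
Definition finally_compact_subset (theta : Type) (X : topologicalType)
    (A : set X) :=
  finally_compact theta (set_type A).

Definition closed_finally_compact (theta : Type) (X : topologicalType) :
    set (set X) :=
  [set A | closed A /\ finally_compact_subset theta A].
Arguments closed_finally_compact : clear implicits.

(* The ideals and ring quotients of [ring_quotient] require 1 != 0; C_c(X) is
   the zero ring when X is empty, so they are redone over [comPzRingType]. An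
   [ideal] need not be proper. *)
HB.mixin Record isMulAbsorbing (A : comPzRingType) (I : A -> bool) := {
  ideal_mul_subproof : forall a : A, {in I, forall u, a * u \in I}
}.

#[short(type="ideal")]
HB.structure Definition Ideal (A : comPzRingType) :=
  {I of GRing.ZmodClosed A I & isMulAbsorbing A I}.

Definition maximal_ideal (A : comPzRingType) (M : ideal A) :=
  1 \notin M /\
  forall J : ideal A, 1 \notin J -> {subset M <= J} -> {subset J <= M}.

Section ideal_quotient.
Variables (A : comPzRingType) (I : ideal A).
Local Open Scope quotient_scope.

Definition ideal_quotient : Type := Quotient.quot I.
HB.instance Definition _ := GRing.Zmodule.on ideal_quotient.
HB.instance Definition _ := EqQuotient.on ideal_quotient.

Definition idealq_one : ideal_quotient := \pi_(Quotient.quot I) 1.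
Definition idealq_mul (x y : ideal_quotient) : ideal_quotient :=
  \pi_(Quotient.quot I) (repr (x : Quotient.quot I) * repr (y : Quotient.quot I)).

Lemma idealq_mul_pi (a b : A) :
  idealq_mul (\pi_(Quotient.quot I) a) (\pi_(Quotient.quot I) b) = \pi_(Quotient.quot I) (a * b).
Proof.
apply/eqP; rewrite /idealq_mul -Quotient.idealrBE.
set a' := repr _; set b' := repr _.
have aa' : a' - a \in I by rewrite Quotient.idealrBE reprK.
have bb' : b' - b \in I by rewrite Quotient.idealrBE reprK.
have -> : a' * b' - a * b = a' * (b' - b) + b * (a' - a).
  by rewrite !mulrBr (mulrC b a') (mulrC b a) addrA subrK.
by rewrite rpredD// ideal_mul_subproof.
Qed.

Fact idealq_mulA : associative idealq_mul.
Proof.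
move=> x y z; rewrite -[x](@reprK _ (Quotient.quot I)) -[y](@reprK _ (Quotient.quot I)).
by rewrite -[z](@reprK _ (Quotient.quot I)) !idealq_mul_pi mulrA.
Qed.

Fact idealq_mulC : commutative idealq_mul.
Proof. by move=> x y; rewrite /idealq_mul mulrC. Qed.

Fact idealq_mul1 : left_id idealq_one idealq_mul.
Proof.
by move=> x; rewrite -[x](@reprK _ (Quotient.quot I)) idealq_mul_pi mul1r.
Qed.

Fact idealq_mulD : left_distributive idealq_mul +%R.
Proof.
have piD (a b : A) : \pi_(Quotient.quot I) a + \pi_(Quotient.quot I) b =
    \pi_(Quotient.quot I) (a + b) :> ideal_quotient.
  exact/esym/Quotient.pi_add.
move=> x y z; rewrite -[x](@reprK _ (Quotient.quot I)).
rewrite -[y](@reprK _ (Quotient.quot I)) -[z](@reprK _ (Quotient.quot I)).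
by rewrite !idealq_mul_pi !piD idealq_mul_pi mulrDl.
Qed.

HB.instance Definition _ := GRing.Zmodule_isComPzRing.Build ideal_quotient
  idealq_mulA idealq_mulC idealq_mul1 idealq_mulD.
End ideal_quotient.

Definition ring_isomorphic (A B : pzRingType) :=
  exists phi : {rmorphism A -> B}, bijective phi.

Section function_rings.
Variables (R : realType) (X : topologicalType).

Definition C_fun : set (X -> R) := [set f | continuous f].

Definition Cc_pred : {pred X -> R} :=
  fun f => `[< C_fun f /\ countable (range f) >].

Fact Cc_subring_closed : subring_closed Cc_pred.
Proof.
have closed2 (op : R -> R -> R) f g :
    (forall x, {for x, continuous f} -> {for x, continuous g} ->
       {for x, continuous (fun y => op (f y) (g y))}) ->
    f \in Cc_pred -> g \in Cc_pred -> (fun y => op (f y) (g y)) \in Cc_pred.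
  move=> cop /asboolP[cf Nf] /asboolP[cg Ng]; apply/asboolP; split.
    by move=> x; apply: cop; [exact: cf | exact: cg].
  have := countableX Nf Ng; apply: sub_countable.
  have sub : range (fun y => op (f y) (g y)) `<=`
      (fun p => op p.1 p.2) @` (range f `*` range g).
    by move=> _ [y _ <-]; exists (f y, g y).
  exact: card_le_trans (subset_card_le sub) (card_image_le _ _).
split=> [|f g fC gC|f g fC gC].
- apply/asboolP; split; first by move=> x; exact: cst_continuous.
  apply: sub_countable (countable1 (1 : R)); apply: subset_card_le.
  by move=> _ [y _ <-].
- by apply: (closed2 (fun a b => a - b)) fC gC => x; exact: continuousB.
- by apply: (closed2 (fun a b => a * b)) fC gC => x; exact: continuousM.
Qed.

HB.instance Definition _ :=
  GRing.isSubringClosed.Build (X -> R) Cc_pred Cc_subring_closed.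

Record Cc_type := CcFun { Cc_val :> X -> R ; _ : Cc_val \in Cc_pred }.
HB.instance Definition _ := [isSub for Cc_val].
HB.instance Definition _ := [Choice of Cc_type by <:].
HB.instance Definition _ :=
  GRing.SubChoice_isSubComPzRing.Build (X -> R) Cc_pred Cc_type Cc_subring_closed.

Definition real_ideal (M : ideal Cc_type) :=
  maximal_ideal M /\ ring_isomorphic (ideal_quotient M) R.

Definition fixed_ideal (M : ideal Cc_type) :=
  exists x : X, forall f : Cc_type, f \in M -> f x = 0.

Definition c_realcompact :=
  forall M : ideal Cc_type, real_ideal M -> fixed_ideal M.

Definition zero_set (f : X -> R) : set X := [set x | f x = 0].

Definition C_ideal (P : set (set X)) : set (X -> R) :=
  [set f | C_fun f /\ P (closure (~` zero_set f))].

(* C(X, Z), seen inside C(X). *)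
Definition CZ_fun : set (X -> R) :=
  [set f | exists2 g : X -> discrete_topology int,
             continuous g & f = fun x => (g x : int)%:~R].

Definition c_stable (P : set (set X)) (F : set (set X)) :=
  forall f, (CZ_fun `&` C_ideal P) f -> exists2 A, F A & [bounded f x | x in A].

Definition c_compact (P : set (set X)) :=
  forall F : set (set X), F `<=` closed -> c_stable P F -> finI F id ->
  \bigcap_(A in F) A !=set0.

End function_rings.

(* Main.v *)
From HB Require Import structures.
Require Import Defs.
From mathcomp Require Import all_boot all_order all_algebra finmap.
From mathcomp Require Import generic_quotient ring_quotient.
From mathcomp Require Import all_classical all_reals all_analysis.
From mathcomp Require Import zify.

(**
  If an open cover [U] has no subcover of cardinality [< theta], the complements
  of unions of fewer than [theta] members of [U] form a filter base of closed
  sets with empty intersection. It is stable: the support of a function of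
  [C_P] is finally [theta]-compact, hence covered by fewer than [theta] members
  of [U], and the function vanishes on the complement of their union.

  Conversely, if [X] is finally [theta]-compact then every closed set is in
  the ideal, so a stable family with the finite intersection property
  generates a filter on some member of which each given integer-valued
  continuous function is bounded. An ultrafilter above it has a member in
  every countable clopen cover, since the first index at which a point is
  covered is such a function. Hence every [f] in [C_c(X)] converges along it:
  the radii of the balls used to test convergence can be chosen so that their
  preimages are clopen, the range of [f] being countable. The limit is a ring
  morphism onto the reals, whose kernel is a real maximal ideal; a point at
  which this ideal is fixed lies in all the clopen sets of the ultrafilter,
  hence in all the closed sets of the family.
*)

Set Implicit Arguments.
Unset Strict Implicit.
Unset Printing Implicit Defensive.

Import Order.TTheory GRing.Theory Num.Theory.
Import numFieldNormedType.Exports.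

Local Open Scope classical_set_scope.

(** * Cardinals *)

(** Any choice of images along [r] is injective by the second hypothesis. A relation lets images be
    described by cases, with no function built by hand. *)
Lemma card_le_rel T U (A : set T) (B : set U) (r : T -> U -> Prop) :
  (forall a, A a -> exists2 b, B b & r a b) ->
  (forall a a' b, A a -> A a' -> r a b -> r a' b -> a = a') ->
  (A #<= B)%card.
Proof.
move=> rAB rinj.
have /choice[f fP] (a : A) : exists b : B, r (val a) (val b).
  by have [b Bb rab] := rAB _ (set_valP a); exists (SigSub (mem_set Bb)).
have injf : injective f.
  move=> a a' faa'; apply/val_inj/(rinj _ _ (val (f a))); try exact: set_valP.
    exact: fP.
  by rewrite faa'; exact: fP.
apply/card_leP.
by have /injfunPex[] : exists2 g : A -> B, set_fun setT setT g & set_inj setT g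
  by exists f => // ? ? _ _; exact: injf.
Qed.

Lemma card_le_inj T U (A : set T) (B : set U) :
  (A #<= B)%card -> exists f : A -> B, injective f.
Proof. by move=> /card_leP[f]; exists f => x y; apply: inj; rewrite ?inE. Qed.

(** By Zorn's lemma there is a maximal graph of a partial injection from [A] to [B]. It is total on
    [A] or onto [B], since otherwise a pair of missed points could be added. *)
Lemma card_le_total T U (A : set T) (B : set U) :
  (A #<= B)%card \/ (B #<= A)%card.
Proof.
pose P (G : set (T * U)) := [/\ G `<=` A `*` B,
  forall a b b', G (a, b) -> G (a, b') -> b = b' &
  forall a a' b, G (a, b) -> G (a', b) -> a = a'].
have [F FP Ftot|G [[GAB Gfun Ginj] Gmax]] := @Zorn_bigcup _ P.
  split; first by move=> p [G FG]; have [+ _ _] := FP _ FG; apply.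
    move=> a b b' [G FG Gb] [G' FG' G'b'].
    have [_ Gf _] := FP _ FG; have [_ G'f _] := FP _ FG'.
    have [GG'|G'G] := Ftot _ _ FG FG'; first exact: G'f (GG' _ Gb) G'b'.
    exact: Gf Gb (G'G _ G'b').
  move=> a a' b [G FG Gb] [G' FG' G'b'].
  have [_ _ Gf] := FP _ FG; have [_ _ G'f] := FP _ FG'.
  have [GG'|G'G] := Ftot _ _ FG FG'; first exact: G'f (GG' _ Gb) G'b'.
  exact: Gf Gb (G'G _ G'b').
have [domG|] := pselect (forall a, A a -> exists b, G (a, b)).
  left; apply: (@card_le_rel _ _ _ _ (fun a b => G (a, b))).
    by move=> a /domG[b Gab]; exists b => //; have [] := GAB _ Gab.
  by move=> a a' b _ _; exact: Ginj.
move=> /existsNP[a /not_implyP[Aa /forallNP Ga]].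
have [ranG|] := pselect (forall b, B b -> exists a, G (a, b)).
  right; apply: (@card_le_rel _ _ _ _ (fun b a => G (a, b))).
    by move=> b /ranG[c Gab]; exists c => //; have [] := GAB _ Gab.
  by move=> b b' c _ _; exact: Gfun.
move=> /existsNP[b /not_implyP[Bb /forallNP Gb]].
exfalso; apply: (Gmax (G `|` [set (a, b)])).
  split; first exact: subsetUl.
  by move=> /(_ (a, b)) /(_ (or_intror erefl))/Ga.
split; first by move=> p [/GAB//|->].
  move=> x y y' [Gxy|[-> ->]] [Gxy'|].
  - exact: Gfun Gxy Gxy'.
  - by move=> [xa _]; move: Gxy; rewrite xa => /Ga.
  - by move: Gxy' => /Ga.
  - by move=> [->].
move=> x x' y [Gxy|[-> ->]] [Gxy'|].
- exact: Ginj Gxy Gxy'.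
- by move=> [_ yb]; move: Gxy; rewrite yb => /Gb.
- by move: Gxy' => /Gb.
- by move=> [->].
Qed.

(* A maximal family of disjoint countably infinite sequences of [T] exhausts [T]
   up to a finite set, and each sequence can be split in two. *)
Lemma card_le_double T : infinite_set [set: T] ->
  ([set: T * bool] #<= [set: T])%card.
Proof.
move=> infT.
pose P (G : set (nat -> T)) := (forall g, G g -> injective g) /\
  forall g g' n n', G g -> G g' -> g n = g' n' -> g = g'.
have [F FP Ftot|G [[Ginj Gdisj] Gmax]] := @Zorn_bigcup _ P.
  split=> [g [G FG Gg]|g g' n n' [G FG Gg] [G' FG' Gg']].
    by have [+ _] := FP _ FG; exact.
  have [GG'|G'G] := Ftot _ _ FG FG'.
    by have [_] := FP _ FG'; apply => //; exact: GG'.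
  by have [_] := FP _ FG; apply => //; exact: G'G.
(* The points on no sequence of [G]: if there were infinitely many, a sequence of them could be
   added to [G]. *)
pose C := [set x | forall g n, G g -> g n <> x].
have finC : finite_set C.
  apply: contrapT => /infiniteP/card_le_inj[f injf].
  pose h n := val (f (SigSub (mem_set (I : [set: nat] n)))).
  have Ch n : C (h n) by exact: set_valP.
  have injh : injective h by move=> n m /val_inj/injf[].
  apply: (Gmax (G `|` [set h])).
    split; first exact: subsetUl.
    move=> /(_ h (or_intror erefl)) Gh.
    exact: (Ch 0%N h 0%N).
  split=> [g [/Ginj//|->//]|g g' n n' [Gg|->] [Gg'|->]//].
  - exact: Gdisj.
  - by move=> /(Ch n').
  - by move=> /esym/(Ch n).
have [g0 Gg0] : exists g, G g.
  apply: contrapT => /forallNP G0; apply/infT/sub_finite_set/finC => x _ g n.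
  by move=> /G0.
have /card_le_inj[c injc] : (C #<= [set: nat])%card.
  exact: finite_set_countable.
(* Each sequence [g] takes the two copies of its own points at the indices 0 and 1 modulo 4. The
   indices 2 and 3 modulo 4 of [g0] are free for the two copies of [C], numbered by [c]. *)
pose r (p : T * bool) y :=
  (exists g n, [/\ G g, p.1 = g n & y = g (4 * n + p.2)%N])
  \/ exists x : C, p.1 = val x /\ y = g0 (4 * val (c x) + 2 + p.2)%N.
apply: (@card_le_rel _ _ _ _ r) => [[x b] _|].
  have [Cx|/existsNP[g /existsNP[n /not_implyP[Gg /contrapT gx]]]] :=
    pselect (C x).
    by exists (g0 (4 * val (c (SigSub (mem_set Cx))) + 2 + b)%N) => //;
      right; exists (SigSub (mem_set Cx)).
  by exists (g (4 * n + b)%N) => //; left; exists g, n.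
move=> [x b] [x' b'] y _ _ [[g [n [Gg /= -> ->]]]|[z [/= -> ->]]]
  [[g' [n' [Gg' /= -> e]]]|[z' [/= -> e]]].
- have gg' := Gdisj _ _ _ _ Gg Gg' e.
  move: e; rewrite gg' => /(Ginj _ Gg') /= e.
  by suff [-> ->] : n = n' /\ b = b' by []; case: b b' e => -[] /=; lia.
- have gg' := Gdisj _ _ _ _ Gg Gg0 e.
  move: e; rewrite gg' => /(Ginj _ Gg0) /= e.
  by exfalso; case: b b' e => -[] /=; lia.
- have gg' := Gdisj _ _ _ _ Gg0 Gg' e.
  move: e; rewrite -gg' => /(Ginj _ Gg0) /= e.
  by exfalso; case: b b' e => -[] /=; lia.
- move: e => /(Ginj _ Gg0) /= e.
  suff [/val_inj/injc -> ->] : val (c z) = val (c z') /\ b = b' by [].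
  by case: b b' e => -[] /=; lia.
Qed.

Lemma card_setU_le T U (A B : set T) (C : set U) : infinite_set C ->
  (A #<= C)%card -> (B #<= C)%card -> (A `|` B #<= C)%card.
Proof.
move=> infC /card_le_inj[f injf] /card_le_inj[g injg].
have infC' : infinite_set [set: C].
  apply: contra_not infC; apply: card_le_finite.
  by rewrite (card_le_eqr (card_setT C)).
rewrite -(card_le_eqr (card_setT C)).
apply: card_le_trans (card_le_double infC').
(* The boolean tag tells whether [x] is sent as a point of [A] or of [B]. *)
pose r x (p : C * bool) := if p.2 then exists2 a, x = val a & p.1 = f a
                           else exists2 b, x = val b & p.1 = g b.
apply: (@card_le_rel _ _ _ _ r) => [x [Ax|Bx]|x x' [c []]/= _ _].
- exists (f (SigSub (mem_set Ax)), true) => //.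
  by exists (SigSub (mem_set Ax)).
- exists (g (SigSub (mem_set Bx)), false) => //.
  by exists (SigSub (mem_set Bx)).
- by move=> [a -> /= ->] [a' -> /= /injf ->].
- by move=> [a -> /= ->] [a' -> /= /injg ->].
Qed.

(** The larger of the two sets absorbs the smaller if it is infinite; if it is finite, so is the
    union, which then cannot dominate [C]. *)
Lemma card_lt_setU T U (A B : set T) (C : set U) : infinite_set C ->
  card_lt A C -> card_lt B C -> card_lt (A `|` B) C.
Proof.
move=> infC /andP[AC CA] /andP[BC CB]; apply/andP; split.
  exact: card_setU_le.
apply/negP => CAB.
have absorb (D E : set T) : (D #<= E)%card -> ~~ (C #<= E)%card ->
    ~ (C #<= D `|` E)%card.
  move=> DE /negP CE CDE; apply: CE; apply: (card_le_trans CDE).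
  have [finE|infE] := pselect (finite_set E); last exact: card_setU_le.
  exfalso; apply: infC; apply: (card_le_finite CDE).
  by rewrite finite_setU; split=> //; exact: card_le_finite finE.
have [AB|BA] := card_le_total A B; first exact: absorb AB CB CAB.
by apply: (absorb _ _ BA CA); rewrite setUC.
Qed.

Lemma card_le_lt_trans T U V (A : set T) (B : set U) (C : set V) :
  (A #<= B)%card -> card_lt B C -> card_lt A C.
Proof.
move=> AB /andP[BC CB]; apply/andP; split; first exact: card_le_trans BC.
by apply: contra CB => CA; exact: card_le_trans AB.
Qed.

Lemma card_lt_set0 T U (C : set U) : infinite_set C -> card_lt (@set0 T) C.
Proof.
move=> infC; rewrite /card_lt card_ge0 /=; apply/negP => C0.
exact/infC/(card_le_finite C0).
Qed.

(** * Final compactness *)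

(** Extend each relatively open set to an open set of [X], and complete the cover with the
    complement of [A]. Distinct relatively open sets have distinct extensions, so the cardinality
    does not grow on the way back. *)
Lemma finally_compact_closed (theta : Type) (X : topologicalType) (A : set X) :
  finally_compact theta X -> closed A -> finally_compact_subset theta A.
Proof.
move=> fcX clA U Uop Ucov.
have /choice[h hP] (O : set A) :
    exists O' : set X, U O -> open O' /\ set_val @^-1` O' = O.
  have [/Uop[ O' O'op O'E]|nUO] := pselect (U O); first by exists O'.
  by exists set0.
have [| |V [VU Vcov Vlt]] := fcX (h @` U `|` [set ~` A]).
- by move=> _ [[ O /hP[? _] <-]//|->]; exact: closed_openC.
- rewrite -subTset => x _; have [Ax|nAx] := pselect (A x); last first.
    by exists (~` A) => //; right.
  have : [set: A] (SigSub (mem_set Ax)) by [].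
  rewrite -Ucov => -[ O UO Ox]; exists (h O); first by left; exists O.
  by have [_ OE] := hP _ UO; move: Ox; rewrite -{1}OE.
exists (U `&` h @^-1` V); split => //.
- rewrite -subTset => x _; have : [set: X] (val x) by [].
  rewrite -Vcov => -[ O' VO' O'x]; have [[ O UO OE]|O'A] := VU _ VO'.
    exists O; first by split=> //=; rewrite OE.
    by have [_ <-] := hP _ UO; rewrite OE.
  by move: O'x; rewrite O'A => -[]; exact: set_valP.
- apply: card_le_lt_trans Vlt.
  apply: (@card_le_rel _ _ _ _ (fun O O' => h O = O')) => [ O [_ VO]|O1 O2 O'].
    by exists (h O).
  move=> [/hP[_ O1E] _] [/hP[_ O2E] _] e1 e2.
  by rewrite -O1E -O2E e1 e2.
Qed.

(** Pass to the traces on [A], then pick one member of [U] for each trace that is kept. *)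
Lemma finally_compact_subset_cover (theta : Type) (X : topologicalType)
    (A : set X) (U : set (set X)) :
  finally_compact_subset theta A -> U `<=` open -> A `<=` \bigcup_(O in U) O ->
  exists V, [/\ V `<=` U, A `<=` \bigcup_(O in V) O & card_lt V [set: theta]].
Proof.
move=> fcA Uop Ucov; pose r (O : set X) : set A := set_val @^-1` O.
have [| |V [VU Vcov Vlt]] := fcA (r @` U).
- by move=> _ [ O /Uop Oop <-]; exists O.
- rewrite -subTset => x _; have [ O UO Ox] := Ucov _ (set_valP x).
  by exists (r O) => //; exists O.
have /choice[h hP] (O' : set A) : exists O, V O' -> U O /\ r O = O'.
  have [/VU[ O UO OE]|nVO] := pselect (V O'); first by exists O.
  by exists setT.
exists (h @` V); split.
- by move=> _ [ O' /hP[? _] <-].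
- move=> x Ax; have : [set: A] (SigSub (mem_set Ax)) by [].
  rewrite -Vcov => -[ O' VO' O'x]; exists (h O'); first by exists O'.
  by have [_ OE] := hP _ VO'; move: O'x; rewrite -{1}OE.
- by apply: card_le_lt_trans Vlt; exact: card_image_le.
Qed.

Lemma c_compact_finally_compact (R : realType) (theta : Type)
    (X : topologicalType) :
  infinite_set [set: theta] -> c_compact R (closed_finally_compact theta X) ->
  finally_compact theta X.
Proof.
move=> inf cX U Uop Ucov; apply: contrapT => nV.
pose small V := V `<=` U /\ card_lt V [set: theta].
pose F : set (set X) := [set ~` (\bigcup_(O in V) O) | V in small].
have [] : \bigcap_(A in F) A !=set0; last first.
  (* No point lies in all members of [F]: a single member of [U] containing it is already a small
     subfamily. *)
  move=> x Fx; have : [set: X] x by [].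
  rewrite -Ucov => -[ O UO Ox]; apply: (Fx (~` (\bigcup_(O' in [set O]) O'))).
    exists [set O] => //; split; first by move=> _ ->.
    apply/andP; split.
      apply: (@card_le_trans _ _ _ [set: nat]); last exact/infiniteP.
      exact: finite_set_countable.
    by apply/negP => /card_le_finite /(_ (finite_set1 _)).
  by exists O.
apply: cX.
- move=> _ [V [VU _] <-]; apply: open_closedC; apply: bigcup_open => O /VU.
  exact: Uop.
- move=> f [_ [cf [_ fcS]]].
  have [|V [VU Vcov Vlt]] := finally_compact_subset_cover fcS Uop.
    by move=> x _; rewrite Ucov.
  exists (~` (\bigcup_(O in V) O)); first by exists V.
  exists 0%R; split=> [|M M0 x Vx /=]; first exact: real0.
  suff -> : f x = 0%R by rewrite normr0 ltW.
  by apply: contrapT => fx; apply/Vx/Vcov/subset_closure.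
(* Since [F] is closed under finite intersections, an empty one would be the complement of the union
   of a small subfamily, that is, of a small subcover. *)
- have FI A B : F A -> F B -> F (A `&` B).
    move=> [V [VU Vlt] <-] [W [WU Wlt] <-]; exists (V `|` W).
      by split; [rewrite subUset; split|exact: card_lt_setU].
    by rewrite bigcup_setU setCU.
  have FT : F setT.
    exists set0; last by rewrite bigcup_set0 setC0.
    by split; [exact: sub0set|exact: card_lt_set0].
  move=> D DF; have : F (\bigcap_(A in [set` D]) A).
    rewrite bigcap_fset big_seq; apply: (big_ind F) => // A AD.
    exact/set_mem/DF.
  move=> [V [VU Vlt] VE]; apply: contrapT => /set0P/negP/negPn/eqP D0.
  apply: nV; exists V; split => //.
  by rewrite -[LHS]setCK VE D0 setC0.
Qed.

Local Open Scope ring_scope.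

(** * Ring quotients *)

Section ring_kernel.
Variables (A : comPzRingType) (K : fieldType) (phi : {rmorphism A -> K}).

Definition ring_kernel_pred : A -> bool := fun a => phi a == 0.

Fact ring_kernel_zmod_closed : zmod_closed ring_kernel_pred.
Proof.
split=> [|a b]; rewrite /in_mem /= /ring_kernel_pred ?rmorph0//.
by move=> /eqP a0 /eqP b0; rewrite rmorphB a0 b0 subrr.
Qed.

HB.instance Definition _ :=
  GRing.isZmodClosed.Build A ring_kernel_pred ring_kernel_zmod_closed.

Fact ring_kernel_mulr a :
  {in ring_kernel_pred, forall u, a * u \in ring_kernel_pred}.
Proof.
move=> u; rewrite /in_mem /= /ring_kernel_pred rmorphM => /eqP ->.
by rewrite mulr0.
Qed.

HB.instance Definition _ :=
  isMulAbsorbing.Build A ring_kernel_pred ring_kernel_mulr.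

Definition ring_kernel : ideal A := Ideal.clone A ring_kernel_pred _.

Lemma ring_kernelE a : (a \in ring_kernel) = (phi a == 0).
Proof. by []. Qed.

Hypothesis phi_surj : forall y, exists a, phi a = y.

(** If [J] contains some [a] outside the kernel, a preimage [b] of the inverse of [phi a] puts
    [1 - b * a] in the kernel, hence 1 in [J]. *)
Lemma ring_kernel_maximal : maximal_ideal ring_kernel.
Proof.
split=> [|J J1 kerJ a aJ]; first by rewrite ring_kernelE rmorph1 oner_eq0.
rewrite ring_kernelE; apply: contraNT J1 => a0.
have [b phib] := phi_surj (phi a)^-1.
have /kerJ abJ : 1 - b * a \in ring_kernel.
  by rewrite ring_kernelE rmorphB rmorphM rmorph1 phib mulVf// subrr.
by rewrite -(subrK (b * a) 1) rpredD// ideal_mul_subproof.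
Qed.

Lemma ideal_quotient_ring_kernel :
  ring_isomorphic (ideal_quotient ring_kernel) K.
Proof.
pose f (q : ideal_quotient ring_kernel) :=
  phi (repr (q : Quotient.quot ring_kernel)).
(* The value of [f] does not depend on the representative chosen by [repr]. *)
have fpi (a : A) : f (\pi_(Quotient.quot ring_kernel) a)%qT = phi a.
  apply/eqP; rewrite /f -subr_eq0 -rmorphB -ring_kernelE Quotient.idealrBE.
  by rewrite reprK.
have reprE (q : ideal_quotient ring_kernel) :
    exists a, q = (\pi_(Quotient.quot ring_kernel) a)%qT.
  by exists (repr (q : Quotient.quot ring_kernel)); rewrite reprK.
have fB : zmod_morphism f.
  move=> x y; have [[a ->] [b ->]] := (reprE x, reprE y).
  rewrite !fpi -rmorphB -fpi; congr f.
  exact: (esym (raddfB \pi_(Quotient.quot ring_kernel)%qT _ _)).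
have fM : monoid_morphism f.
  split=> [|x y]; first by rewrite fpi rmorph1.
  have [[a ->] [b ->]] := (reprE x, reprE y).
  by rewrite /GRing.mul /= idealq_mul_pi !fpi rmorphM.
pose F := HB.pack_for {rmorphism ideal_quotient ring_kernel -> K} f
  (GRing.isZmodMorphism.Build _ _ f fB) (GRing.isMonoidMorphism.Build _ _ f fM).
have /choice[g gK] := phi_surj.
exists F; exists (fun y => (\pi_(Quotient.quot ring_kernel) (g y))%qT) => [q|y].
  have [a ->] := reprE q; rewrite -[F _]/(f _) fpi; apply/eqP.
  by rewrite -Quotient.idealrBE ring_kernelE rmorphB gK subrr.
by rewrite -[F _]/(f _) fpi gK.
Qed.
End ring_kernel.

(** * Clopen ultrafilters *)

(** Otherwise the interval from 0 to [e] would be countable, hence of Lebesgue measure zero. *)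
Lemma countable_avoid (R : realType) (A : set R) (e : R) :
  countable A -> 0 < e -> exists2 d, 0 < d <= e & ~ A d.
Proof.
move=> cA e0; apply: contrapT => h.
have sub : `]0, e]%classic `<=` A.
  move=> d /=; rewrite in_itv /= => de; apply: contrapT => Ad.
  by apply: h; exists d.
have := countable_lebesgue_measure0 (sub_countable (subset_card_le sub) cA).
rewrite lebesgue_measure_itv /= lte_fin e0 sube0 => /eqP.
by rewrite eqe gt_eqF.
Qed.

Lemma indic_Cc (R : realType) (X : topologicalType) (A : set X) :
  clopen A -> (\1_A : X -> R) \in @Cc_pred R X.
Proof.
move=> [Aop Acl]; apply/asboolP; split.
  move=> x; have [Ax|nAx] := pselect (A x).
    apply: (@near_cst_continuous X R 1).
    have : nbhs x A by exact: open_nbhs_nbhs.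
    by apply: filterS => y Ay; rewrite indicE mem_set.
  apply: (@near_cst_continuous X R 0).
  have : nbhs x (~` A).
    by apply: open_nbhs_nbhs; split => //; exact: closed_openC.
  by apply: filterS => y Ay; rewrite indicE memNset.
apply: (@sub_countable _ _ _ [set 0; 1]).
  apply: subset_card_le => _ [x _ <-]; rewrite indicE.
  by case: (x \in A); [right|left].
exact: finite_set_countable.
Qed.

Section ultrafilter.
Variables (R : realType) (X : topologicalType) (U : set_system X).
Hypothesis U_ultra : UltraFilter U.

Lemma clopen_cover_ultra :
  (forall f, @CZ_fun R X f -> exists2 A, U A & [bounded f x | x in A]) ->
  forall A : nat -> set X, (forall n, clopen (A n)) -> \bigcup_n A n = setT ->
  exists n, U (A n).
Proof.
move=> Ubnd A clA covA.
have /choice[g gP] (x : X) :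
    exists n, A n x /\ forall m, (m < n)%N -> ~ A m x.
  have [n _ Anx] : (\bigcup_n A n) x by rewrite covA.
  have exA : exists n, `[< A n x >] by exists n; apply/asboolP.
  exists (ex_minn exA); case: ex_minnP => m /asboolP Amx minm.
  split=> // k km Akx.
  by have := minm k (asboolT Akx); rewrite leqNgt km.
pose G (x : X) : discrete_topology int := Posz (g x).
have cG : continuous G.
  move=> x; apply/discrete_cvg.
  have Ux : nbhs x (A (g x)).
    by apply: open_nbhs_nbhs; split; [exact: (clA _).1 | exact: (gP x).1].
  have : nbhs x [set y | forall i : 'I_(g x), ~ A i y].
    apply: filter_forall => i; apply: open_nbhs_nbhs; split.
      exact: closed_openC (clA i).2.
    exact: (gP x).2.
  (* Near [x], points stay in [A (g x)] and outside the earlier sets, so the first index is locally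
     constant. *)
  apply: filterS2 Ux => y /= Ay nAy; congr Posz.
  have [lt|lt|//] := ltngtP (g y) (g x).
    by have := nAy (Ordinal lt) (gP y).1.
  by have := (gP y).2 _ lt.
have [B UB Bbnd] := Ubnd (fun x => (G x : int)%:~R) (ex_intro2 _ _ G cG erefl).
have [M BM] : exists M : R, forall x, B x -> (g x)%:R <= M.
  (* Boundedness only provides the bounds strictly above [M], hence the shift by 1. *)
  have [M [_ MP]] := Bbnd; exists (M + 1) => x Bx.
  have := MP (M + 1); rewrite ltrDl ltr01 => /(_ isT x Bx) /=.
  by rewrite normr_nat.
apply: contrapT => /forallNP nU.
(* If no [A i] is in [U], their complements are. Finitely many of them exclude every first index
   allowed on [B]. *)
have UN : U [set x | forall i : 'I_(Num.truncn M).+1, ~ A i x].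
  by apply: filter_forall => i; have [/nU|] := in_ultra_setVsetC (A i) U_ultra.
have [x [Bx nAx]] := filter_ex (filterI UB UN).
have lt : (g x < (Num.truncn M).+1)%N.
  by rewrite ltnS truncn_ge_nat ?BM// (le_trans _ (BM _ Bx)).
exact: nAx (Ordinal lt) (gP x).1.
Qed.

Hypothesis U_cover : forall A : nat -> set X,
  (forall n, clopen (A n)) -> \bigcup_n A n = setT -> exists n, U (A n).

Lemma Cc_ultra_cvg (f : Cc_type R X) : cvg ((f : X -> R) @ U).
Proof.
have /asboolP[cf Nf] := valP f; simpl in cf, Nf.
apply: contrapT => ncv.
have /choice[d dP] (r : R) : exists d, [/\ 0 < d,
    clopen [set x | `|r - f x| < d] & ~ U [set x | `|r - f x| < d]].
  have : ~ (f : X -> R) @ U --> r by move=> /cvgP.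
  move=> /cvgrPdist_lt/existsNP[e /not_implyP[e0 nUe]].
  have Nr : countable (range (fun x => `|r - f x|)).
    have -> : range (fun x => `|r - f x|) =
        (fun y => `|r - y|) @` range (f : X -> R).
      by rewrite image_comp.
    exact: sub_countable (card_image_le _ _) Nf.
  have [d /andP[d0 de] nd] := countable_avoid Nr e0.
  have cd : continuous (fun x => `|r - f x|).
    by move=> x; apply: cvg_norm; apply: cvgB; [exact: cvg_cst|exact: cf].
  exists d; split=> //.
    split.
      apply: (@open_comp _ _ (fun x => `|r - f x|) [set y | y < d]).
        by move=> x _; exact: cd.
      exact: open_lt.
    (* The radius [d] is not a value of the distance from [r] to [f], so the strict and large
       inequalities agree. *)
    have -> : [set x | `|r - f x| < d] = [set x | `|r - f x| <= d].
      apply/seteqP; split=> x /=; first exact: ltW.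
      by rewrite le_eqVlt => /orP[/eqP dE|//]; exfalso; apply: nd; exists x.
    apply: (@preimage_closed _ _ (fun x => `|r - f x|) [set y | y <= d]).
      by move=> x _; exact: cd.
    exact: closed_le.
  move=> Ud; apply: nUe; apply: filterS Ud => x /= /lt_le_trans; exact.
have [h hf] : exists h : nat -> R, range (f : X -> R) `<=` range h.
  have /pfcard_geP[f0|[h]] := Nf; last by exists h; exact: (@surj _ _ _ _ h).
  by exists (fun=> 0); rewrite f0.
(* Balls centred at the countably many values of [f] suffice: each point [x] lies in the one centred
   at [f x]. *)
have [n| |n Un] := U_cover (A := fun n => [set x | `|h n - f x| < d (h n)]).
- by have [] := dP (h n).
- rewrite -subTset => x _; have [|n _ hn] := hf (f x); first by exists x.
  by exists n => //=; rewrite hn subrr normr0; have [] := dP (f x).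
- by have [_ _] := dP (h n).
Qed.

Lemma clopen_ultra_point : c_realcompact R X ->
  exists x, forall A, clopen A -> U A -> A x.
Proof.
move=> rcX; pose phi (f : Cc_type R X) : R := lim ((f : X -> R) @ U).
have phiE (f : Cc_type R X) (r : R) : (f : X -> R) @ U --> r -> phi f = r.
  by move=> fr; apply/cvg_lim.
have phiB : zmod_morphism phi.
  by move=> f g; apply: phiE; apply: cvgB; exact: Cc_ultra_cvg.
have phiM : monoid_morphism phi.
  split=> [|f g]; apply: phiE; first exact: cvg_cst.
  by apply: cvgM; exact: Cc_ultra_cvg.
pose F := HB.pack_for {rmorphism Cc_type R X -> R} phi
  (GRing.isZmodMorphism.Build _ _ phi phiB)
  (GRing.isMonoidMorphism.Build _ _ phi phiM).
have Fsurj (r : R) : exists f, F f = r.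
  have Cr : (fun=> r : R) \in @Cc_pred R X.
    apply/asboolP; split; first by move=> x; exact: cst_continuous.
    apply: sub_countable (countable1 r); apply: subset_card_le.
    by move=> _ [y _ <-].
  by exists (CcFun Cr); apply: phiE; exact: cvg_cst.
have [|x xP] := rcX (ring_kernel F).
  by split; [exact: ring_kernel_maximal|exact: ideal_quotient_ring_kernel].
exists x => A clA UA; apply: contrapT => nAx.
(* The indicator of the complement of [A] has limit 0, so it is in the kernel and must vanish at
   [x]. *)
have fU0 : (\1_(~` A) : X -> R) @ U --> (0 : R).
  apply: cvg_near_cst; apply: filterS UA => y Ay.
  by rewrite indicE memNset//= => -[].
pose f := CcFun (indic_Cc R (clopenC A clA)).
have : f x = 0 by apply: xP; rewrite ring_kernelE; exact/eqP/(phiE f).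
rewrite /f /= => /eqP.
by rewrite indicE mem_set// oner_eq0.
Qed.

End ultrafilter.

Lemma finally_compact_c_compact (R : realType) (theta : Type)
    (X : topologicalType) :
  has_clopen_base X -> c_realcompact R X -> finally_compact theta X ->
  c_compact R (closed_finally_compact theta X).
Proof.
move=> [B [_ Bx] Bcl] rcX fcX F Fcl Fst /finI_filter FF.
have [U [U_ultra FU]] := ultraFilterLemma FF.
have UF A : F A -> U A.
  by move=> FA; apply: FU; exists A => //; exact: (@finI_from1 _ _ F id).
have Ubnd (f : X -> R) : CZ_fun f -> exists2 A, U A & [bounded f x | x in A].
  move=> Zf; have [|A /UF UA fA] := Fst f; last by exists A.
  have cf : continuous f.
    move: Zf => [g cg ->] x.
    have gx : nbhs x (g @^-1` [set g x]) by apply: cg; exact: discrete_set1.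
    apply: (@near_cst_continuous X R (g x : int)%:~R).
    by apply: filterS gx => y /= ->.
  by split=> //; split=> //; split; [exact: closed_closure|
    apply: finally_compact_closed => //; exact: closed_closure].
have [x xU] := clopen_ultra_point U_ultra (clopen_cover_ultra U_ultra Ubnd) rcX.
exists x => A FA; apply: contrapT => nAx.
(* A basic clopen [C] around [x] missing [A] has its complement in [U], so [x] would lie in that
   complement. *)
have /Bx[C [BC Cx] CA] : nbhs x (~` A).
  by apply: open_nbhs_nbhs; split => //; exact: closed_openC (Fcl _ FA).
have UC : U (~` C) by apply: filterS (UF _ FA) => y Ay Cy; exact: CA Cy Ay.
exact: (xU _ (clopenC C (Bcl _ BC)) UC).
Qed.

Theorem theorem3p5 (R : realType) (theta : Type)
  (theta_infinite : infinite_set [set: theta])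
  (X : topologicalType) (X_clopen_base : has_clopen_base X)
  (X_hausdorff : hausdorff_space X) (X_c_realcompact : c_realcompact R X) :
  finally_compact theta X <->
  c_compact R (closed_finally_compact theta X).
Proof.
split; first exact: finally_compact_c_compact.
exact: c_compact_finally_compact.
Qed.
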